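(* Let $X,Y,Z$ be complex Banach spaces, let $c\in\mathbb{C}\setminus\{0\}$, let $\mathcal{B}$ be a non-empty collection of non-empty subsets of $X$ such that every $x\in X$ belongs to some $B\in\mathcal{B}$, and let $\emptyset\neq I'\subseteq I\subseteq\mathbb{R}^n$ with $I+I'\subseteq I$. Let $F:I\times X\to Y$ and $G:I\times Y\to Z$ be continuous, put $R(F):=\{F(\mathbf{t};x):\mathbf{t}\in I,\ x\in X\}$, and suppose that there exists a finite real constant $L>0$ such that $$\|G(\mathbf{t};y)-G(\mathbf{t};y')\|_Z\le L\|y-y'\|_Y,\qquad \mathbf{t}\in I,\ y\in R(F),\ y'\in cR(F).$$ Define $W:I\times X\to Z$ by $W(\mathbf{t};x):=G(\mathbf{t};F(\mathbf{t};x))$. (i) Suppose further that for every $B\in\mathcal{B}$ and $\epsilon>0$ there exists $l>0$ such that for each $\mathbf{t}_0\in I'$ there exists $\tau\in B(\mathbf{t}_0,l)\cap I'$ such that $$\|F(\mathbf{t}+\tau;x)-cF(\mathbf{t};x)\|_Y\le\epsilon,\qquad \mathbf{t}\in I,\ x\in B,$$ and $$\|G(\mathbf{t}+\tau;cy)-cG(\mathbf{t};y)\|_Z\le\epsilon,\qquad \mathbf{t}\in I,\ y\in R(F).$$ Then $W$ is Bohr $(\mathcal{B},I',c)$-almost periodic. (ii) Suppose further that for every $B\in\mathcal{B}$ there exists a sequence $(\tau_k)$ in $I'$ such that $\lim_{k\to+\infty}|\tau_k|=+\infty$, $$\lim_{k\to+\infty}\sup_{\mathbf{t}\in I,\,x\in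 B}\|F(\mathbf{t}+\tau_k;x)-cF(\mathbf{t};x)\|_Y=0$$ and $$\lim_{k\to+\infty}\sup_{\mathbf{t}\in I,\,x\in B}\|G(\mathbf{t}+\tau_k;cF(\mathbf{t};x))-cG(\mathbf{t};F(\mathbf{t};x))\|_Z=0.$$ Then $W$ is $(\mathcal{B},I',c)$-uniformly recurrent.
   Context: Here $n\in\mathbb{N}=\{1,2,\dots\}$, $|\cdot|$ is the Euclidean norm on $\mathbb{R}^n$, $B(\mathbf{t}_0,l):=\{\mathbf{t}\in\mathbb{R}^n:|\mathbf{t}-\mathbf{t}_0|\le l\}$ and $cR(F):=\{cy:y\in R(F)\}$. Let $H:I\times X\to Z$ be continuous. $H$ is Bohr $(\mathcal{B},I',c)$-almost periodic if for every $B\in\mathcal{B}$ and $\epsilon>0$ there exists $l>0$ such that for each $\mathbf{t}_0\in I'$ there exists $\tau\in B(\mathbf{t}_0,l)\cap I'$ such that $\|H(\mathbf{t}+\tau;x)-cH(\mathbf{t};x)\|_Z\le\epsilon$ for all $\mathbf{t}\in I$, $x\in B$. $H$ is $(\mathcal{B},I',c)$-uniformly recurrent if for every $B\in\mathcal{B}$ there exists a sequence $(\tau_k)$ in $I'$ such that $\lim_{k\to+\infty}|\tau_k|=+\infty$ and $\lim_{k\to+\infty}\sup_{\mathbf{t}\in I,\,x\in B}\|H(\mathbf{t}+\tau_k;x)-cH(\mathbf{t};x)\|_Z=0$. *)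

(* Defs.v *)
From mathcomp Require Import all_boot all_order all_algebra.
From mathcomp Require Import complex.
From mathcomp Require Import all_classical all_reals all_analysis.

Set Implicit Arguments.
Unset Strict Implicit.
Unset Printing Implicit Defensive.

Import Order.TTheory GRing.Theory Num.Theory.
Import numFieldNormedType.Exports.

Local Open Scope classical_set_scope.
Local Open Scope ring_scope.

(* Over the scalar field R[i], the library norm `|x| has type R[i]. Its value
   is a nonnegative real, so taking the real part loses nothing (see
   [rnormE]). *)
Definition rnorm (R : realType) (V : normedModType R[i]) (x : V) : R :=
  complex.Re `|x|.

Lemma rnormE (R : realType) (V : normedModType R[i]) (x : V) :
  `|x| = real_complex R (rnorm x).
Proof.
have /ger0_real : 0 <= `|x| by exact: normr_ge0.
rewrite /rnorm; case: `|x| => a b.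
by rewrite complex_real => /= /eqP ->.
Qed.

(* The library norm on 'rV[R]_n is the max norm; it induces the same topology
   as the Euclidean norm. *)
Definition enorm (R : realType) (n : nat) (t : 'rV[R]_n) : R :=
  Num.sqrt (\sum_(i < n) t 0 i ^+ 2).

Definition eball (R : realType) (n : nat) (t0 : 'rV[R]_n) (l : R) :
  set 'rV[R]_n := [set t | enorm (t - t0) <= l].

(* A map H : I x V -> W is represented by a total curried function; its values
   at points t outside I play no role, as long as I is stable under the
   translations considered. *)
Definition jointly_continuous (R : realType) (n : nat)
    (V W : normedModType R[i]) (I : set 'rV[R]_n) (H : 'rV[R]_n -> V -> W) :
  Prop := {within I `*` setT, continuous (fun p : 'rV[R]_n * V => H p.1 p.2)}.

Definition image_on (R : realType) (n : nat) (V W : normedModType R[i])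
    (I : set 'rV[R]_n) (H : 'rV[R]_n -> V -> W) : set W :=
  [set y | exists2 t, I t & exists x, y = H t x].

Definition sup_norm_on (R : realType) (n : nat) (V W : normedModType R[i])
    (I : set 'rV[R]_n) (B : set V) (D : 'rV[R]_n -> V -> W) : \bar R :=
  ereal_sup [set (rnorm (D p.1 p.2))%:E | p in I `*` B].

Definition bohr_almost_periodic (R : realType) (n : nat)
    (V W : normedModType R[i]) (BB : set (set V)) (I I' : set 'rV[R]_n)
    (c : R[i]) (H : 'rV[R]_n -> V -> W) : Prop :=
  jointly_continuous I H /\
  forall (B : set V) (eps : R), BB B -> 0 < eps ->
    exists2 l : R, 0 < l &
      forall t0, I' t0 -> exists2 tau, (eball t0 l `&` I') tau &
        forall t x, I t -> B x -> rnorm (H (t + tau) x - c *: H t x) <= eps.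

Definition uniformly_recurrent (R : realType) (n : nat)
    (V W : normedModType R[i]) (BB : set (set V)) (I I' : set 'rV[R]_n)
    (c : R[i]) (H : 'rV[R]_n -> V -> W) : Prop :=
  jointly_continuous I H /\
  forall B : set V, BB B ->
    exists tau : nat -> 'rV[R]_n,
      [/\ forall k, I' (tau k),
          enorm (tau k) @[k --> \oo] --> +oo &
          sup_norm_on I B (fun t x => H (t + tau k) x - c *: H t x)
            @[k --> \oo] --> 0%E].

(* Main.v *)
(** Insert [G (t + tau) (c *: F t x)] between [W (t + tau) x] and
    [c *: W t x]: since [t + tau] stays in [I], the first increment is at most
    [L] times the [F]-translation error by the Lipschitz condition, and the
    second is the [G]-translation error along [y = F t x]. *)
Require Import Defs.
From mathcomp Require Import all_boot all_order all_algebra.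
From mathcomp Require Import complex.
From mathcomp Require Import all_classical all_reals all_analysis.

Import Order.TTheory GRing.Theory Num.Theory.
Import numFieldNormedType.Exports.

Local Open Scope classical_set_scope.
Local Open Scope ring_scope.

Lemma rnorm_ge0 {R : realType} {V : normedModType R[i]} (x : V) :
  0 <= rnorm x.
Proof. by rewrite -lecR -rnormE normr_ge0. Qed.

Lemma ler_rnormD {R : realType} {V : normedModType R[i]} (x y : V) :
  rnorm (x + y) <= rnorm x + rnorm y.
Proof. by rewrite -lecR rmorphD /= -!rnormE ler_normD. Qed.

(** [W] factors through [(t, x) |-> (t, F t x)], which fixes the first coordinate and so maps
    [I x X] into [I x Y], where [G] is continuous relative to that set. *)
Lemma jointly_continuous_comp {R : realType} {n : nat}
    {X Y Z : normedModType R[i]} {I : set 'rV[R]_n}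
    {F : 'rV[R]_n -> X -> Y} {G : 'rV[R]_n -> Y -> Z} :
  jointly_continuous I F -> jointly_continuous I G ->
  jointly_continuous I (fun t x => G t (F t x)).
Proof.
move=> /subspace_continuousP F_cont /subspace_continuousP G_cont.
apply/subspace_continuousP => -[t x] [/= It _].
have F_lim : (p.1, F p.1 p.2) @[p --> within (I `*` setT) (nbhs (t, x))]
    --> (t, F t x).
  apply: (@cvg_pair _ _ _ _ (nbhs t) (nbhs (F t x))).
    by apply: cvg_within_filter; exact: cvg_fst.
  exact: (F_cont (t, x)).
(* [F_lim] only reaches the full neighbourhood filter of [(t, F t x)], while [G_cont] needs the
   filter restricted to [I x Y]. The upgrade holds because [p.1] is in [I] whenever [p] is in
   [I x X]. *)
have FP : (fun p => (p.1, F p.1 p.2)) @ within (I `*` setT) (nbhs (t, x))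
    `=>` within (I `*` setT) (nbhs (t, F t x)).
  move=> A /F_lim FA.
  have {}FA : \forall p \near (t, x), (I `*` setT) p ->
      (I `*` setT) (p.1, F p.1 p.2) -> A (p.1, F p.1 p.2) := FA.
  change (\forall p \near (t, x), (I `*` setT) p -> A (p.1, F p.1 p.2)).
  by apply: filterS FA => p Ap Ip; apply: Ap => //; case: Ip.
exact: (cvg_comp _ _ FP (G_cont (t, F t x) _)).
Qed.

Section sup_norm_on.
Context {R : realType} {n : nat} {V W : normedModType R[i]}.
Implicit Types (I : set 'rV[R]_n) (B : set V) (D : 'rV[R]_n -> V -> W).

Lemma sup_norm_on_ub {I B} D {t x} :
  I t -> B x -> ((rnorm (D t x))%:E <= sup_norm_on I B D)%E.
Proof. by move=> It Bx; apply: ereal_sup_ubound; exists (t, x). Qed.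

(** Any single value of the norm already gives the bound. Nonemptiness matters because [ereal_sup]
    of the empty set is [-oo]. *)
Lemma sup_norm_on_ge0 {I B} D :
  I !=set0 -> B !=set0 -> (0 <= sup_norm_on I B D)%E.
Proof.
move=> [t It] [x Bx]; apply: le_trans (sup_norm_on_ub D It Bx).
by rewrite lee_fin rnorm_ge0.
Qed.

Lemma sup_norm_on_le {I B D} {M : \bar R} :
  (forall t x, I t -> B x -> ((rnorm (D t x))%:E <= M)%E) ->
  (sup_norm_on I B D <= M)%E.
Proof.
move=> DM; apply: ge_ereal_sup => _ [[t x] [/= It Bx] <-].
exact: DM.
Qed.

End sup_norm_on.

Theorem theorem2p19 (R : realType) (n : nat) (n_gt0 : (0 < n)%N)
  (X Y Z : completeNormedModType R[i]) (c : R[i]) (c_neq0 : c != 0)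
  (BB : set (set X)) (BB_neq0 : BB !=set0)
  (BB_mem_neq0 : forall B, BB B -> B !=set0)
  (BB_cover : forall x : X, exists2 B, BB B & B x)
  (I I' : set 'rV[R]_n) (I'_neq0 : I' !=set0) (I'_sub : I' `<=` I)
  (I_add : forall t tau, I t -> I' tau -> I (t + tau))
  (F : 'rV[R]_n -> X -> Y) (G : 'rV[R]_n -> Y -> Z)
  (F_cont : jointly_continuous I F) (G_cont : jointly_continuous I G)
  (G_lip : exists2 L : R, 0 < L &
     forall t y y', I t -> image_on I F y -> [set c *: z | z in image_on I F] y' ->
       rnorm (G t y - G t y') <= L * rnorm (y - y')) :
  let W := fun t x => G t (F t x) in
  ((forall (B : set X) (eps : R), BB B -> 0 < eps ->
      exists2 l : R, 0 < l &
        forall t0, I' t0 -> exists2 tau, (eball t0 l `&` I') tau &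
          (forall t x, I t -> B x ->
             rnorm (F (t + tau) x - c *: F t x) <= eps) /\
          (forall t y, I t -> image_on I F y ->
             rnorm (G (t + tau) (c *: y) - c *: G t y) <= eps)) ->
   bohr_almost_periodic BB I I' c W)
  /\
  ((forall B : set X, BB B ->
      exists tau : nat -> 'rV[R]_n,
        [/\ forall k, I' (tau k),
            enorm (tau k) @[k --> \oo] --> +oo,
            sup_norm_on I B (fun t x => F (t + tau k) x - c *: F t x)
              @[k --> \oo] --> 0%E &
            sup_norm_on I B (fun t x =>
                G (t + tau k) (c *: F t x) - c *: G t (F t x))
              @[k --> \oo] --> 0%E]) ->
   uniformly_recurrent BB I I' c W).
Proof.
move=> W; have [L L_gt0 GL] := G_lip.
have W_le t tau x : I t -> I' tau ->
    rnorm (W (t + tau) x - c *: W t x) <=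
    L * rnorm (F (t + tau) x - c *: F t x) +
    rnorm (G (t + tau) (c *: F t x) - c *: G t (F t x)).
  move=> It I'tau; rewrite /W.
  rewrite -(subrKA (G (t + tau) (c *: F t x))).
  apply: le_trans (ler_rnormD _ _) _; rewrite lerD2r.
  (* The Lipschitz condition is taken at time [t + tau], with [y = F (t + tau) x] in [R(F)] and
     [y' = c *: F t x] in [cR(F)]. *)
  apply: GL; first exact: I_add.
    by exists (t + tau); [exact: I_add | exists x].
  by exists (F t x) => //; exists t => //; exists x.
have W_cont : jointly_continuous I W by exact: jointly_continuous_comp.
split=> [FG_ap | FG_ur]; split=> //.
- move=> B eps BB_B eps_gt0.
  have L1_gt0 : 0 < L + 1 by rewrite addr_gt0.
  (* With tolerance [d = eps / (L + 1)] for both translation errors, the bound [W_le] becomes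
     [L * d + d = eps]. *)
  have [l l_gt0 Hl] := FG_ap B _ BB_B (divr_gt0 eps_gt0 L1_gt0).
  exists l => // t0 /Hl[tau [tau_ball I'tau] [F_le G_le]].
  exists tau => // t x It Bx.
  have -> : eps = L * (eps / (L + 1)) + eps / (L + 1).
    by rewrite -[X in _ = _ + X]mul1r -mulrDl mulrC divfK ?gt_eqF.
  apply: le_trans (W_le _ _ _ It I'tau) _; apply: lerD.
    by rewrite ler_pM2l //; exact: F_le.
  by apply: G_le => //; exists t => //; exists x.
- move=> B BB_B; have [tau [I'tau tau_oo F_cvg G_cvg]] := FG_ur B BB_B.
  exists tau; split=> //.
  have I_neq0 : I !=set0 by have [t /I'_sub It] := I'_neq0; exists t.
  have B_neq0 := BB_mem_neq0 _ BB_B.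
  pose DF k t x := F (t + tau k) x - c *: F t x.
  pose DG k t x := G (t + tau k) (c *: F t x) - c *: G t (F t x).
  (* The same [tau] works for [W]: its supremum lies between 0 and [L] times the supremum for [F]
     plus the one for [G]. The upper bound comes from [W_le] pointwise, each summand then being
     bounded by its own supremum. *)
  apply: (@squeeze_cvge _ _ _ _ (cst 0%E) _ (fun k =>
      L%:E * sup_norm_on I B (DF k) + sup_norm_on I B (DG k))%E).
  + apply: nearW => k; rewrite sup_norm_on_ge0 //=.
    apply: sup_norm_on_le => t x It Bx.
    apply: (@le_trans _ _ (L * rnorm (DF k t x) + rnorm (DG k t x))%:E).
      by rewrite lee_fin; exact: W_le.
    rewrite EFinD EFinM; apply: leeD; last exact: sup_norm_on_ub.
    apply: lee_wpmul2l; last exact: sup_norm_on_ub.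
    by rewrite lee_fin ltW.
  + exact: cvg_cst.
  (* Both limit rules are safe in the extended reals here: the factor [L%:E] is finite, and the two
     limits being added are both 0. *)
  + have LF_cvg : (L%:E * sup_norm_on I B (DF k))%E @[k --> \oo] --> 0%E.
      by rewrite -(mule0 L%:E); exact: cvgeZl.
    by rewrite -(adde0 0%E); exact: cvgeD.
Qed.
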